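(* Let $R$ be a ring. (a) If $M$ is a weakly uniserial right $R$-module such that ${\rm Soc}(M)$ is Dedekind-finite, then $N \subseteq {\rm Soc}(M)$ or ${\rm Soc}(M) \subseteq N$ for every submodule $N$ of $M$. Moreover, ${\rm Soc}(M)=0$ or $M$ is indecomposable or $M$ is homogeneous semisimple. (b) If $R$ is a right weakly uniserial ring such that ${\rm Soc}(R_{R})$ is Dedekind-finite, then ${\rm J}(R)^{2}=0$ or ${\rm Soc}(R_{R})^2= 0$. Moreover, ${\rm Soc}(R_{R})=0$ or $R_{R}$ is indecomposable or $R \cong M_{n}(D)$ for some division ring $D$ and integer $n\geq 1$.
   Context: Rings are associative with identity $1\neq 0$ and modules are unitary right modules. A module $M$ is called weakly uniserial if for any two submodules $N$ and $K$ of $M$ there exists an injective module homomorphism $N\to K$ or an injective module homomorphism $K\to N$. A ring $R$ is right weakly uniserial if the right module $R_R$ is weakly uniserial. ${\rm Soc}(M)$ is the socle of $M$ and ${\rm J}(R)$ the Jacobson radical of $R$. A right $R$-module $M$ is Dedekind-finite if for every right $R$-module $N$, $M\cong M\oplus N$ implies $N=0$. A semisimple module is homogeneous if any two of its simple submodules are isomorphic. *)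

(* Defs.v *)
From HB Require Import structures.
From mathcomp Require Import all_boot all_algebra.
From mathcomp Require Import boolp.

Set Implicit Arguments.
Unset Strict Implicit.
Unset Printing Implicit Defensive.

Import GRing.Theory.
Local Open Scope ring_scope.

(* [lmodType A] is the type of left modules over [A], so a right [R]-module is
   an [lmodType] over the converse ring [R^c], with [a *: x] read as x a. *)
Notation rmodType R := (lmodType R^c).

(* In [(R^c)^o] one has [a *: x = x * a], product taken in [R]: this is the
   right regular module R_R. *)
Definition right_regular (R : nzRingType) : rmodType R := (R^c)^o.

Section Modules.
Variable A : nzRingType.

Section Submodule.
Variables (M : lmodType A) (N : submodClosed M).

Record submod : Type := Submod { submod_val : M; _ : submod_val \in N }.

HB.instance Definition _ := [isSub for submod_val].
HB.instance Definition _ := [Choice of submod by <:].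
HB.instance Definition _ := [SubChoice_isSubLmodule of submod by <:].

End Submodule.

Definition embeds (M N : lmodType A) : Prop :=
  exists f : {linear M -> N}, injective f.

Definition isomorphic (M N : lmodType A) : Prop :=
  exists f : {linear M -> N}, bijective f.

Definition weakly_uniserial (M : lmodType A) : Prop :=
  forall N K : submodClosed M,
    embeds (submod N) (submod K) \/ embeds (submod K) (submod N).

Definition Dedekind_finite (M : lmodType A) : Prop :=
  forall N : lmodType A, isomorphic M (M * N)%type -> forall x : N, x = 0.

Definition simple_module (M : lmodType A) : Prop :=
  (exists x : M, x != 0) /\
  forall N : submodClosed M, N =i pred1 0 \/ N =i predT.

Definition simple_submod (M : lmodType A) (S : submodClosed M) : Prop :=
  simple_module (submod S).

Definition soc (M : lmodType A) : {pred M} := fun x =>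
  `[< exists (n : nat) (y : 'I_n -> M),
        (forall i, exists2 S : submodClosed M, simple_submod S & y i \in S)
        /\ x = \sum_(i < n) y i >].

Arguments soc M _ : clear implicits.

Lemma soc_submod_closed (M : lmodType A) : GRing.subsemimod_closed (soc M).
Proof.
split; [split|] => [|x z|a x].
- by apply/asboolP; exists 0, (fun=> 0); split=> [[]|] //; rewrite big_ord0.
- move=> /asboolP[m [y [yS ->]]] /asboolP[n [t [tS ->]]].
  apply/asboolP; exists (m + n)%N.
  exists (fun i => match split i with inl j => y j | inr j => t j end).
  split=> [i|]; first by case: (split i).
  rewrite big_split_ord /=; congr (_ + _); apply: eq_bigr => i _.
    by rewrite -[lshift n i]/(unsplit (inl i)) unsplitK.
  by rewrite -[rshift m i]/(unsplit (inr i)) unsplitK.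
- move=> /asboolP[m [y [yS ->]]]; apply/asboolP; exists m, (fun i => a *: y i).
  rewrite scaler_sumr; split=> // i; have [S sS yiS] := yS i.
  by exists S => //; apply: rpredZ.
Qed.

HB.instance Definition _ (M : lmodType A) :=
  GRing.isSubmodClosed.Build A M (soc M) (soc_submod_closed M).

Definition Soc (M : lmodType A) : submodClosed M := soc M.

Definition indecomposable (M : lmodType A) : Prop :=
  (exists x : M, x != 0) /\
  forall N K : submodClosed M,
    (forall x, x \in N -> x \in K -> x = 0) ->
    (forall x, exists y z, [/\ y \in N, z \in K & x = y + z]) ->
    N =i pred1 0 \/ K =i pred1 0.

Definition semisimple (M : lmodType A) : Prop := Soc M =i predT.

Definition homogeneous (M : lmodType A) : Prop :=
  forall S T : submodClosed M, simple_submod S -> simple_submod T ->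
    isomorphic (submod S) (submod T).

End Modules.

Section Rings.
Variable R : nzRingType.

Definition right_weakly_uniserial : Prop := weakly_uniserial (right_regular R).

Definition maximal_right_ideal (m : submodClosed (right_regular R)) : Prop :=
  ~ m =i predT /\
  forall I : submodClosed (right_regular R),
    {subset m <= I} -> I =i m \/ I =i predT.

Definition Jacobson_radical : {pred R} := fun x =>
  `[< forall m : submodClosed (right_regular R),
        maximal_right_ideal m -> x \in m >].

Definition right_socle : {pred R} := Soc (right_regular R).

(* Product of two additive subgroups: finite sums of products. *)
Definition ideal_mul (I J : {pred R}) : {pred R} := fun x =>
  `[< exists (n : nat) (a b : 'I_n -> R),
        (forall i, a i \in I /\ b i \in J) /\ x = \sum_(i < n) a i * b i >].

End Rings.

Arguments Jacobson_radical R _ : clear implicits.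
Arguments right_socle R _ : clear implicits.

Definition division_ring (D : unitRingType) : Prop :=
  forall x : D, x != 0 -> x \is a GRing.unit.

Definition ring_isomorphic (R S : pzRingType) : Prop :=
  exists f : {rmorphism R -> S}, bijective f.

(* Main.v *)
(* Between simple submodules every embedding is an isomorphism, so a weakly
   uniserial M has a homogeneous socle. If Soc M embeds in N, the image is a
   direct summand of Soc M isomorphic to Soc M, hence all of Soc M by
   Dedekind-finiteness; if N embeds in Soc M, then N is a sum of simple modules,
   being a linear image of Soc M through a projection. This is the comparability
   in (a), and two complementary summands comparable to a nonzero socle can only
   be proper if both lie in the socle. For (b), compare J(R) with the socle and
   use Soc(R_R) J(R) = 0. When R_R is homogeneous semisimple, a shortest way of
   writing 1 as a sum of elements of simple right ideals gives orthogonal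
   idempotents; isomorphisms between these ideals complete them to matrix units,
   whose centralizer is the division ring D. *)
Require Import Defs.
From HB Require Import structures.
From mathcomp Require Import all_boot all_algebra.
From mathcomp Require Import boolp.
From mathcomp Require classical_sets.
Set Implicit Arguments.
Unset Strict Implicit.
Unset Printing Implicit Defensive.
Import GRing.Theory.
Local Open Scope ring_scope.

(** * Simple submodules, the socle and its direct summands *)

Section Modules.
Variable A : nzRingType.
Implicit Types M P : lmodType A.

Lemma exists_submod M (P : M -> Prop) :
  P 0 -> (forall x y, P x -> P y -> P (x + y)) ->
  (forall a x, P x -> P (a *: x)) ->
  exists N : submodClosed M, forall x, x \in N <-> P x.
Proof.
move=> P0 PD PZ; pose p : {pred M} := fun x => `[< P x >].
have pP : GRing.subsemimod_closed p.
  split; [split|] => [|x y /asboolP Px /asboolP Py|a x /asboolP Px];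
    apply/asboolP; [exact: P0 | exact: PD | exact: PZ].
pose pM := GRing.isSubmodClosed.Build A M p pP.
by exists (HB.pack_for (submodClosed M) p pM) => x; split=> /asboolP.
Qed.

Lemma exists_linear M P (f : M -> P) : linear f ->
  exists g : {linear M -> P}, g =1 f.
Proof.
move=> f_lin; pose fM := GRing.isLinear.Build A M P *:%R f f_lin.
by exists (HB.pack_for {linear M -> P} f fM).
Qed.

Lemma isomorphic_sym M P : isomorphic M P -> isomorphic P M.
Proof.
move=> [f [g fK gK]]; have [h hE] := exists_linear (can2_linear fK gK).
by exists h, f => x; rewrite hE.
Qed.

Lemma inj_surj_isomorphic M P (f : {linear M -> P}) :
  injective f -> (forall y, exists x, f x = y) -> isomorphic M P.
Proof.
by move=> f_inj /choice[g fgK]; exists f, g => // x; apply: f_inj.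
Qed.

(** Elementwise form of simplicity: any nonzero element generates. Later arguments can then work
    inside [M] and avoid submodules of the subtype [submod S]. *)
Lemma simple_submodP M (S : submodClosed M) :
  simple_submod S <->
  (exists2 x, x \in S & x != 0) /\
  {in S &, forall x y, x != 0 -> exists a, y = a *: x}.
Proof.
split=> [[[[x xS] x0] simpS]|[[x xS x0] cycS]]; split.
- by exists x.
- move=> y z yS zS y0.
  have [|u v [a au] [b bv]|a u [b bu]|N NP] := @exists_submod (submod S)
    (fun u => exists a, val u = a *: y).
  + by exists 0; rewrite scale0r.
  + by exists (a + b); rewrite scalerDl -au -bv.
  + by exists (a * b); rewrite -scalerA -bu.
  case: (simpS N) => [/(_ (Submod yS))|/(_ (Submod zS))].
    rewrite [RHS]inE; suff -> : Submod yS \in N.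
      by move=> /esym/eqP[yE]; rewrite yE eqxx in y0.
    by apply/NP; exists 1; rewrite scale1r.
  by rewrite [RHS]inE => /NP.
- by exists (Submod xS); apply: contra x0 => /eqP[->].
- move=> N; have [[u uN u0]|N0] := pselect (exists2 u, u \in N & u != 0).
    right=> v; rewrite [RHS]inE.
    have [a va] := cycS (val u) (val v) (valP u) (valP v) u0.
    suff -> : v = a *: u by apply: rpredZ.
    exact: val_inj.
  left=> u; rewrite [RHS]inE; apply/idP/eqP=> [uN|->]; last exact: rpred0.
  by apply: contra_notP N0 => /eqP u0; exists u.
Qed.

Lemma socP M (x : M) :
  x \in Soc M <-> exists (n : nat) (y : 'I_n -> M),
    (forall i, exists2 S : submodClosed M, simple_submod S & y i \in S)
    /\ x = \sum_(i < n) y i.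
Proof. by split=> /asboolP. Qed.

Lemma simple_sub_soc M (S : submodClosed M) :
  simple_submod S -> {subset S <= Soc M}.
Proof.
move=> simpS x xS; apply/socP; exists 1, (fun=> x).
by rewrite big_ord1; split=> // _; exists S.
Qed.

(** A linear map sends each simple submodule to zero or to a simple submodule, and it preserves
    finite sums. *)
Lemma soc_linear_image M P (h : {linear submod (Soc M) -> P}) x : h x \in Soc P.
Proof.
have /socP[n [y [yS xE]]] := valP x.
have ySoc i : y i \in Soc M by have [S /simple_sub_soc] := yS i; apply.
have -> : x = \sum_(i < n) Submod (ySoc i).
  by apply: val_inj; rewrite xE raddf_sum.
rewrite linear_sum; apply: rpred_sum => i _.
have [S simpS yiS] := yS i; have [->|hy0] := eqVneq (h (Submod (ySoc i))) 0.
  exact: rpred0.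
have [||a u [s sS us]|T TP] := @exists_submod P
    (fun u => exists2 s : submod (Soc M), val s \in S & u = h s).
- by exists 0; rewrite ?raddf0 ?rpred0.
- move=> u v [s sS ->] [t tS ->]; exists (s + t); last by rewrite raddfD.
  exact: rpredD.
- by exists (a *: s); [exact: rpredZ | rewrite us linearZ].
have yT : h (Submod (ySoc i)) \in T by apply/TP; exists (Submod (ySoc i)).
apply: (simple_sub_soc _ yT); apply/simple_submodP; split.
  by exists (h (Submod (ySoc i))).
move=> _ _ /TP[s sS ->] /TP[t tS ->] hs0.
have /simple_submodP[_ cycS] := simpS.
have [|a ta] := cycS (val s) (val t) sS tS.
  apply: contra hs0 => /eqP s0; have -> : s = 0 by apply: val_inj.
  by rewrite linear0.
by exists a; rewrite -linearZ; congr (h _); apply: val_inj.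
Qed.

(** Zorn's lemma gives a submodule [K] of the socle maximal among those meeting [N] trivially. A
    simple submodule not inside [N + K] could be added to [K], so maximality puts the whole socle
    inside [N + K]. *)
Lemma soc_complement M (N : submodClosed M) :
  exists K : submodClosed M,
    [/\ {subset K <= Soc M}, forall x, x \in N -> x \in K -> x = 0
      & forall x, x \in Soc M -> exists y z, [/\ y \in N, z \in K & x = y + z]].
Proof.
pose ok (K : submodClosed M) :=
  {subset K <= Soc M} /\ forall x, x \in N -> x \in K -> x = 0.
pose T := {K | ok K}; pose R (K L : T) := `[< {subset sval K <= sval L} >].
have [K0 K0P] : exists K : submodClosed M, forall x, x \in K <-> x = 0.
  apply: exists_submod => [//|x y -> ->|a x ->]; first by rewrite addr0.
  by rewrite scaler0.
have ok0 : ok K0 by split=> x; [move/K0P->; apply: rpred0 | move=> _ /K0P].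
have [|K L Q|C C_tot|K' Kmax] :=
  @classical_sets.ZL_preorder T (exist _ K0 ok0) R.
- by move=> K; apply/asboolP.
- by move=> /asboolP KL /asboolP LQ; apply/asboolP => x /KL/LQ.
(* Upper bound of a chain: its union, with 0 adjoined to cover the empty chain. *)
- have [||a x [->|[L CL xL]]|U UP] := @exists_submod M
    (fun x => x = 0 \/ exists2 L, C L & x \in sval L).
  + by left.
  + move=> x y [->|[L CL xL]]; first by rewrite add0r.
    move=> [->|[Q CQ yQ]]; first by rewrite addr0; right; exists L.
    right; have [/asboolP LQ|/asboolP QL] := C_tot L Q CL CQ.
      by exists Q => //; apply: rpredD => //; apply: LQ.
    by exists L => //; apply: rpredD => //; apply: QL.
  + by left; rewrite scaler0.
  + by right; exists L => //; apply: rpredZ.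
  have okU : ok U.
    split=> x => [/UP[->|[L CL xL]]|xN /UP[//|[L CL xL]]]; first exact: rpred0.
      by have [LS _] := svalP L; apply: LS.
    by have [_] := svalP L; apply.
  by exists (exist _ U okU) => L CL; apply/asboolP => x xL; apply/UP; right; exists L.
have [KS KN] := svalP K'; set K := sval K' in KS KN *.
exists K; split=> // _ /socP[n [y [yS ->]]].
have [||a x [u [v [uN vK ->]]]|Q QP] := @exists_submod M
  (fun x => exists u v, [/\ u \in N, v \in K & x = u + v]).
- by exists 0, 0; rewrite !rpred0 addr0.
- move=> x z [u [v [uN vK ->]]] [t [w [tN wK ->]]].
  by exists (u + t), (v + w); rewrite !rpredD // addrACA.
- by exists (a *: u), (a *: v); rewrite !rpredZ // scalerDr.
apply/QP/rpred_sum => i _; have [S simpS yiS] := yS i.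
(* If [y i] is outside [Q], the sum of [N] and [K], then [S] meets [Q] trivially by simplicity. So
   [L], the sum of [K] and [S], still meets [N] trivially, against the maximality of [K]. *)
apply: contrapT => /negP yiQ.
have SQ s : s \in S -> s \in Q -> s = 0.
  move=> sS sQ; apply/eqP; apply: contraNT yiQ => s0.
  by have /simple_submodP[_ /(_ s (y i) sS yiS s0)[a ->]] := simpS; apply: rpredZ.
have [||a x [k [s [kK sS ->]]]|L LP] := @exists_submod M
  (fun x => exists k s, [/\ k \in K, s \in S & x = k + s]).
- by exists 0, 0; rewrite !rpred0 addr0.
- move=> x z [u [v [uN vK ->]]] [t [w [tN wK ->]]].
  by exists (u + t), (v + w); rewrite !rpredD // addrACA.
- by exists (a *: k), (a *: s); rewrite !rpredZ // scalerDr.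
have okL : ok L.
  split=> x.
    move=> /LP[k [s [kK sS ->]]]; apply: rpredD; first exact: KS.
    exact: simple_sub_soc sS.
  move=> xN /LP[k [s [kK sS xE]]]; have s0 : s = 0.
    apply: SQ => //; apply/QP; exists x, (- k); split=> //.
      by rewrite -scaleN1r rpredZ.
    by rewrite xE addrAC subrr add0r.
  by apply: KN => //; rewrite xE s0 addr0.
move/negP: yiQ; apply; apply/QP; exists 0, (y i).
rewrite rpred0 add0r; split=> //.
have /asboolP : R (exist _ L okL) K'.
  apply: Kmax; apply/asboolP => x xK; apply/LP; exists x, 0.
  by rewrite rpred0 addr0.
apply; apply/LP; exists 0, (y i).
by rewrite rpred0 add0r.
Qed.

Lemma subset_soc_of_injection M (N : submodClosed M)
    (f : {linear submod N -> M}) :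
  injective f -> (forall x, f x \in Soc M) -> {subset N <= Soc M}.
Proof.
move=> f_inj fSoc.
have [||a x [u ->]|I IP] := @exists_submod M (fun x => exists u, x = f u).
- by exists 0; rewrite linear0.
- by move=> _ _ [u ->] [v ->]; exists (u + v); rewrite linearD.
- by exists (a *: u); rewrite linearZ.
have [K [KS KI SIK]] := soc_complement I.
have KI0 (u : submod N) : f u \in K -> u = 0.
  by move=> uK; apply: f_inj; rewrite linear0; apply: KI uK; apply/IP; exists u.
(* h is f^-1 composed with the projection of Soc M onto the image of f along K. *)
have /choice[h hP] (x : submod (Soc M)) :
    exists u : submod N, val x - f u \in K.
  have [_ [z [/IP[u ->] zK ->]]] := SIK _ (valP x).
  by exists u; rewrite addrAC subrr add0r.
(* [K] meets the image of [f] trivially, so the choice made by [h] is forced; linearity of [h]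
   follows from this uniqueness. *)
have hE x u : val x - f u \in K -> h x = u.
  move=> xuK; apply/subr0_eq/KI0; rewrite linearB.
  have -> : f (h x) - f u = (val x - f u) - (val x - f (h x)).
    by rewrite opprB [RHS]addrC addrA addrNK.
  by rewrite rpredD // -scaleN1r rpredZ.
have h_lin : linear h.
  move=> a x y; apply: hE.
  have -> : f (a *: h x + h y) = a *: f (h x) + f (h y) by rewrite linearP.
  rewrite (_ : _ - _ = a *: (val x - f (h x)) + (val y - f (h y))).
    by rewrite rpredD ?rpredZ.
  by rewrite opprD addrACA scalerBr.
have vh_lin : linear (fun x => val (h x)) by move=> a x y; rewrite h_lin.
have [g gE] := exists_linear vh_lin.
move=> n nN; have -> : n = g (Submod (fSoc (Submod nN))).
  by rewrite gE (hE _ (Submod nN)) // subrr rpred0.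
exact: soc_linear_image.
Qed.

(** For a complement [K] of the image of [f] in the socle, the map taking [(u, k)] to [f u + k] is
    an isomorphism from the product of [Soc M] and [K] onto [Soc M]. Dedekind-finiteness forces [K]
    to vanish. *)
Lemma Dedekind_soc_surjective M (f : {linear submod (Soc M) -> M}) :
  Dedekind_finite (submod (Soc M)) -> injective f ->
  forall x, x \in Soc M -> exists u, x = f u.
Proof.
move=> Dfin f_inj.
have [||a x [u ->]|I IP] := @exists_submod M (fun x => exists u, x = f u).
- by exists 0; rewrite linear0.
- by move=> _ _ [u ->] [v ->]; exists (u + v); rewrite linearD.
- by exists (a *: u); rewrite linearZ.
have [K [KS KI SIK]] := soc_complement I.
have gS (p : submod (Soc M) * submod K) : f p.1 + val p.2 \in Soc M.
  by rewrite rpredD ?soc_linear_image // KS // (valP p.2).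
have g_lin : linear (fun p => Submod (gS p)).
  by move=> a p q; apply: val_inj; rewrite /= linearP scalerDr addrACA.
have [g gE] := exists_linear g_lin.
have g_inj : injective g.
  move=> p q pq; apply/subr0_eq; move/eqP: pq; rewrite -subr_eq0 -linearB.
  move: (p - q) => [u k] /eqP; rewrite gE => -[uk0].
  have k0 : val k = 0.
    apply: KI (valP k); apply/IP; exists (- u).
    by rewrite linearN; apply/eqP; rewrite -addr_eq0 addrC uk0.
  have u0 : u = 0 by apply: f_inj; rewrite linear0 -uk0 k0 addr0.
  by congr (_, _) => //; apply: val_inj.
have K0 : forall k : submod K, k = 0.
  apply: Dfin; apply/isomorphic_sym/(inj_surj_isomorphic g_inj) => x.
  have [_ [z [/IP[u ->] zK xE]]] := SIK _ (valP x).
  by exists (u, Submod zK); rewrite gE; apply: val_inj.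
move=> x /SIK[_ [z [/IP[u ->] zK ->]]]; exists u.
by have [->] := K0 (Submod zK); rewrite addr0.
Qed.

Lemma simple_embedding_isomorphic M (S T : submodClosed M) :
  simple_submod S -> simple_submod T ->
  embeds (submod S) (submod T) -> isomorphic (submod S) (submod T).
Proof.
move=> /simple_submodP[[x xS x0] _] /simple_submodP[_ cycT] [f f_inj].
apply: inj_surj_isomorphic (f_inj) _ => y.
have [|a ya] := cycT (val (f (Submod xS))) (val y) (valP _) (valP _).
  apply: contra x0 => /eqP fx0; have : f (Submod xS) = f 0.
    by rewrite linear0; apply: val_inj.
  by case/f_inj=> ->.
by exists (a *: Submod xS); rewrite linearZ; apply: val_inj.
Qed.

(** * Weakly uniserial modules with Dedekind-finite socle: part (a) *)

Lemma weakly_uniserial_homogeneous M : weakly_uniserial M -> homogeneous M.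
Proof.
move=> wuM S T simpS simpT; have [|] := wuM S T.
  exact: simple_embedding_isomorphic.
by move/(simple_embedding_isomorphic simpT simpS)/isomorphic_sym.
Qed.

Lemma weakly_uniserial_soc_comparable M (N : submodClosed M) :
  weakly_uniserial M -> Dedekind_finite (submod (Soc M)) ->
  {subset N <= Soc M} \/ {subset Soc M <= N}.
Proof.
move=> wuM Dfin; have [[f f_inj]|[f f_inj]] := wuM N (Soc M); [left|right].
  have vf_lin : linear (fun x => val (f x)) by move=> a x y; rewrite linearP.
  have [g gE] := exists_linear vf_lin.
  apply: (@subset_soc_of_injection _ _ g) => [x y|x]; rewrite !gE.
    by move/val_inj/f_inj.
  exact: valP.
have vf_lin : linear (fun x => val (f x)) by move=> a x y; rewrite linearP.
have [g gE] := exists_linear vf_lin => x xS.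
have [|u ->] := @Dedekind_soc_surjective _ g Dfin _ x xS.
  by move=> u v; rewrite !gE => /val_inj/f_inj.
by rewrite gE; apply: valP.
Qed.

Lemma weakly_uniserial_soc_trichotomy M :
  weakly_uniserial M -> Dedekind_finite (submod (Soc M)) ->
  Soc M =i pred1 0 \/ indecomposable M \/ (homogeneous M /\ semisimple M).
Proof.
move=> wuM Dfin; have [[x xS x0]|S0] := pselect (exists2 x, x \in Soc M & x != 0).
  right; have [|ssM] := pselect (indecomposable M); first by left.
  right; split; first exact: weakly_uniserial_homogeneous.
  apply: contrapT => nssM; apply: ssM; split; first by exists x.
  move=> N K NK0 MNK.
  have zero (L : submodClosed M) : (forall y, y \in L -> y = 0) -> L =i pred1 0.
    move=> L0 y; rewrite [RHS]inE; apply/idP/eqP=> [/L0//|->]; exact: rpred0.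
  (* If both summands lie in the socle, [M] is semisimple; if only one does, it is contained in the
     other and is zero; if both contain the socle, so does their zero intersection, against
     [x != 0]. *)
  have [NS|SN] := weakly_uniserial_soc_comparable N wuM Dfin;
  have [KS|SK] := weakly_uniserial_soc_comparable K wuM Dfin.
  - case: nssM => y; rewrite [RHS]inE; have [u [v [uN vK ->]]] := MNK y.
    by apply: rpredD; [exact: NS | exact: KS].
  - by left; apply: zero => y yN; apply: NK0 => //; apply/SK/NS.
  - by right; apply: zero => y yK; apply: NK0 => //; apply/SN/KS.
  - by rewrite (NK0 x) ?SN ?SK ?eqxx in x0.
left=> x; rewrite [RHS]inE; apply/idP/eqP=> [xS|->]; last exact: rpred0.
by apply: contra_notP S0 => /eqP x0; exists x.
Qed.

End Modules.

(** * The centralizer of a family of ring elements, as a ring with units *)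

Section Centralizer.
Variables (R : nzRingType) (I : Type) (e : I -> R).

Definition centralizing : {pred R} := fun x => `[< forall i, x * e i = e i * x >].

Lemma centralizing_subring_closed : subring_closed centralizing.
Proof.
split=> [|x y /asboolP xC /asboolP yC|x y /asboolP xC /asboolP yC];
  apply/asboolP => i; first by rewrite mul1r mulr1.
  by rewrite mulrBl mulrBr xC yC.
by rewrite -mulrA yC mulrA xC mulrA.
Qed.

HB.instance Definition _ :=
  GRing.isSubringClosed.Build R centralizing centralizing_subring_closed.

Record centralizer : Type :=
  Centralizer { centralizer_val : R; _ : centralizer_val \in centralizing }.

HB.instance Definition _ := [isSub for centralizer_val].
HB.instance Definition _ := [Choice of centralizer by <:].
HB.instance Definition _ := [SubChoice_isSubNzRing of centralizer by <:].

Definition centralizer_unit : {pred centralizer} :=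
  fun x => `[< exists y, y * x = 1 /\ x * y = 1 >].

(** An inverse picked by choice; nonunits are fixed, as the unit ring interface demands. *)
Definition centralizer_inv (x : centralizer) : centralizer :=
  match pselect (exists y, y * x = 1 /\ x * y = 1) with
  | left x_unit => sval (cid x_unit)
  | right _ => x
  end.

Lemma centralizer_mulVr : {in centralizer_unit, left_inverse 1 centralizer_inv *%R}.
Proof.
by move=> x /asboolP xU; rewrite /centralizer_inv; case: pselect => // ?;
  case: cid => y [].
Qed.

Lemma centralizer_divrr : {in centralizer_unit, right_inverse 1 centralizer_inv *%R}.
Proof.
by move=> x /asboolP xU; rewrite /centralizer_inv; case: pselect => // ?;
  case: cid => y [].
Qed.

Lemma centralizer_unitrP x y : y * x = 1 /\ x * y = 1 -> centralizer_unit x.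
Proof. by move=> yxy; apply/asboolP; exists y. Qed.

Lemma centralizer_invr_out : {in [predC centralizer_unit], centralizer_inv =1 id}.
Proof.
by move=> x /asboolP xU; rewrite /centralizer_inv; case: pselect.
Qed.

HB.instance Definition _ := GRing.NzRing_hasMulInverse.Build centralizer
  centralizer_mulVr centralizer_divrr centralizer_unitrP centralizer_invr_out.

End Centralizer.

(** * Rings with a full system of matrix units *)

Section MatrixUnits.
Variables (R : nzRingType) (n : nat) (e : 'I_n -> 'I_n -> R).
Hypothesis eM : forall i j k l, e i j * e k l = e i l *+ (j == k).
Hypothesis e1 : \sum_i e i i = 1.

Let E (p : 'I_n * 'I_n) := e p.1 p.2.

(** The [(i, j)] coefficient of [a] seen as a matrix over the centralizer, realized in [R] as a
    scalar matrix: the [k]-th term puts the coefficient at diagonal place [k]. *)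
Let entry (a : R) i j : R := \sum_k e k i * a * e j k.

(** Only the term [k = m] survives. Multiplication on the other side gives the same value in
    [entry_mul], so entries commute with all matrix units. *)
Let mul_entry a i j l m : e l m * entry a i j = e l i * a * e j m.
Proof.
rewrite mulr_sumr (bigD1 m) //= big1 ?addr0 => [|k km].
  by rewrite !mulrA eM eqxx.
by rewrite !mulrA eM eq_sym (negPf km) !mul0r.
Qed.

Let entry_mul a i j l m : entry a i j * e l m = e l i * a * e j m.
Proof.
rewrite mulr_suml (bigD1 l) //= big1 ?addr0 => [|k kl].
  by rewrite -!mulrA eM eqxx.
by rewrite -!mulrA eM (negPf kl) !mulr0.
Qed.

Let entry_centralizing a i j : entry a i j \in centralizing E.
Proof. by apply/asboolP => -[l m]; rewrite entry_mul mul_entry. Qed.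

Lemma matrix_units_isomorphism : ring_isomorphic R 'M[centralizer E]_n.
Proof.
pose f a : 'M[centralizer E]_n :=
  \matrix_(i, j) Centralizer (entry_centralizing a i j).
have fB : zmod_morphism f.
  move=> a b; apply/matrixP => i j; rewrite !mxE; apply: val_inj => /=.
  by rewrite -sumrB; apply: eq_bigr => k _; rewrite mulrBr mulrBl.
have fM : monoid_morphism f.
  split=> [|a b]; apply/matrixP => i j; rewrite !mxE; apply: val_inj.
    rewrite /= /entry; have [->|ij] := eqVneq i j.
      by rewrite -[RHS]e1; apply: eq_bigr => k _; rewrite mulr1 eM eqxx.
    by apply: big1 => k _; rewrite mulr1 eM (negPf ij).
  rewrite raddf_sum.
  transitivity (\sum_m entry a i m * entry b m j); last first.
    by apply: eq_bigr => m _; rewrite !mxE.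
  under [RHS]eq_bigr => m _ do rewrite mulr_suml.
  rewrite exchange_big /=; apply: eq_bigr => k _.
  under eq_bigr => m _ do rewrite -[_ * entry b m j]mulrA mul_entry.
  (* Writing 1 as the sum of the [e m m] between [a] and [b] produces the sum over [m] of the matrix
     product. *)
  rewrite -[in LHS](mulr1 a) -e1 !(mulr_sumr, mulr_suml).
  by apply: eq_bigr => m _; rewrite !mulrA.
pose fZ := GRing.isZmodMorphism.Build _ _ f fB.
pose fMM := GRing.isMonoidMorphism.Build _ _ f fM.
exists (HB.pack_for {rmorphism R -> 'M[centralizer E]_n} f fZ fMM).
(* The inverse reassembles a matrix from its coefficients. It recovers [a] because
   [entry a i j * e i j] is the Peirce component [e i i * a * e j j]. *)
exists (fun D : 'M_n => \sum_i \sum_j val (D i j) * e i j) => [a|D].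
  rewrite -[RHS]mulr1 -[in RHS]e1 -[X in X * _]mul1r -[in X in X * _]e1.
  rewrite !mulr_suml; apply: eq_bigr => i _.
  by rewrite mulr_sumr; apply: eq_bigr => j _; rewrite !mxE /= entry_mul.
apply/matrixP => i j; rewrite !mxE; apply: val_inj => /=.
have DC l m p q : e p q * val (D l m) = val (D l m) * e p q.
  by have /asboolP/(_ (p, q)) := valP (D l m).
(* [D i j] is expanded as the sum of the [D i j * e k k]; on the other side, for each [k], only
   [l = i], [m = j] contributes. *)
rewrite -[RHS]mulr1 -[in RHS]e1 mulr_sumr; apply: eq_bigr => k _.
rewrite mulr_sumr mulr_suml (bigD1 i) //= [X in _ + X]big1 ?addr0 => [|l li].
  rewrite mulr_sumr mulr_suml (bigD1 j) //= [X in _ + X]big1 ?addr0 => [|m mj].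
    by rewrite mulrA DC -!mulrA !eM !eqxx eM eqxx.
  by rewrite mulrA DC -!mulrA eM (negPf mj) !mulr0.
rewrite mulr_sumr mulr_suml big1 // => m _.
by rewrite mulrA DC -[X in X * _]mulrA eM eq_sym (negPf li) mulr0 mul0r.
Qed.

(** The hypothesis says that any nonzero element of [e o o * R] generates it. For nonzero [d] in the
    centralizer, [d * e o o] is such an element, so [e o o = d * e o o * r], and the [(o, o)] entry
    of [r] is a right inverse of [d]. *)
Lemma matrix_units_division (o : 'I_n) :
  (forall x, x != 0 -> e o o * x = x -> exists r, e o o = x * r) ->
  division_ring (centralizer E).
Proof.
move=> e_simple.
have rinv (d : centralizer E) : d != 0 -> exists d', d * d' = 1.
  move=> d0; have /asboolP dC := valP d.
  have dE p q : val d * e p q = e p q * val d := dC (p, q).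
  have de0 : val d * e o o != 0.
    apply: contra d0 => /eqP de0; apply/eqP/val_inj => /=.
    rewrite -[LHS]mulr1 -e1 mulr_sumr big1 // => k _.
    have -> : e k k = e k o * (e o o * e o k) by rewrite !eM !eqxx eM eqxx.
    by rewrite mulrA dE -mulrA [_ * (_ * e o k)]mulrA de0 mul0r mulr0.
  have [|r er] := e_simple _ de0; first by rewrite dE mulrA eM eqxx.
  exists (Centralizer (entry_centralizing r o o)); apply: val_inj => /=.
  rewrite -e1 mulr_sumr; apply: eq_bigr => k _.
  have -> : e k k = e k o * (val d * e o o * r) * e o k.
    by rewrite -er !eM eqxx eM eqxx.
  by rewrite dE !mulrA eM eqxx -dE.
(* Right inverses are two-sided: [d'] has a right inverse [d''] in turn, and [d * d' = 1] then gives
   [d' * d = 1]. *)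
move=> d d0; have [d' dd'] := rinv d d0.
have d'0 : d' != 0.
  by apply: contra_eq_neq dd' => ->; rewrite mulr0 eq_sym oner_neq0.
have [d'' d'd''] := rinv d' d'0.
apply/unitrP; exists d'; split=> //.
by rewrite -[X in _ * X]mulr1 -d'd'' [d * _]mulrA dd' mul1r.
Qed.

End MatrixUnits.

(** * Right ideals, the Jacobson radical and the right socle *)

Section RightIdeals.
Variable R : nzRingType.
Local Notation right_ideal := (submodClosed (right_regular R)).

Lemma exists_right_ideal (P : R -> Prop) :
  P 0 -> (forall x y, P x -> P y -> P (x + y)) ->
  (forall x a, P x -> P (x * a)) ->
  exists I : right_ideal, forall x : R, x \in I <-> P x.
Proof.
move=> P0 PD PM.
exact: (@exists_submod R^c (right_regular R) P P0 PD (fun a x => PM x a)).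
Qed.

Lemma right_ideal0 (I : right_ideal) : (0 : R) \in I.
Proof. exact: (rpred0 I). Qed.

Lemma right_idealD (I : right_ideal) (x y : R) :
  x \in I -> y \in I -> x + y \in I.
Proof. exact: (@rpredD (right_regular R) I x y). Qed.

Lemma right_idealM (I : right_ideal) (x a : R) : x \in I -> x * a \in I.
Proof. exact: (@rpredZ R^c (right_regular R) I a x). Qed.

Lemma simple_right_idealP (S : right_ideal) :
  simple_submod S <->
  (exists2 x : R, x \in S & x != 0) /\
  forall x y : R, x \in S -> y \in S -> x != 0 -> exists a, y = x * a.
Proof.
split=> [/simple_submodP[Sn0 Scyc]|[Sn0 Scyc]].
  by split=> [//|x y xS yS x0]; apply: Scyc.
by apply/simple_submodP; split=> [//|x y xS yS x0]; apply: Scyc.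
Qed.

Lemma right_socleP (x : R) :
  x \in right_socle R <-> exists (n : nat) (y : 'I_n -> R),
    (forall i, exists2 S : right_ideal, simple_submod S & y i \in S)
    /\ x = \sum_(i < n) y i.
Proof. exact: socP. Qed.

(** For [s != 0], the module [s * R = S] is simple, so the right annihilator [m] of [s] is a maximal
    right ideal and contains the radical. *)
Lemma simple_mul_Jacobson (S : right_ideal) (s j : R) :
  simple_submod S -> s \in S -> j \in Jacobson_radical R -> s * j = 0.
Proof.
move=> /simple_right_idealP[_ Scyc] sS /asboolP jJ.
have [->|s0] := eqVneq s 0; first by rewrite mul0r.
have [||x a sx0|m mP] := @exists_right_ideal (fun r => s * r = 0).
- by rewrite mulr0.
- by move=> x y sx0 sy0; rewrite mulrDr sx0 sy0 addr0.
- by rewrite mulrA sx0 mul0r.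
apply/mP/jJ; split=> [mT|I mI].
  have /mP := mT 1; rewrite mulr1 => s_eq0.
  by move: (mT 1); rewrite [RHS]inE => /mP; rewrite mulr1; apply/eqP.
have [[i iI si0]|I0] := pselect (exists2 i : R, i \in I & s * i != 0).
  right=> x; rewrite [RHS]inE.
  (* The nonzero [s * i] generates [S], so [s = s * i * r]; thus [1 - i * r] lies in [m], hence in
     [I], and [I] contains 1. *)
  have [r sr] := Scyc (s * i) s (right_idealM i sS) sS si0.
  have m1 : 1 - i * r \in m by apply/mP; rewrite mulrBr mulr1 mulrA -sr subrr.
  have -> : x = (1 - i * r) * x + i * r * x by rewrite -mulrDl subrK mul1r.
  by apply: right_idealD; do !apply: right_idealM => //; apply: mI.
left=> x; apply/idP/idP=> [xI|]; last exact: mI.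
by apply/mP; apply: contra_notP I0 => /eqP sx0; exists x.
Qed.

Lemma socle_mul_Jacobson (x j : R) :
  x \in right_socle R -> j \in Jacobson_radical R -> x * j = 0.
Proof.
move=> /right_socleP[n [y [yS ->]]] jJ; rewrite mulr_suml big1 // => i _.
by have [S simpS yiS] := yS i; apply: simple_mul_Jacobson simpS yiS jJ.
Qed.

Lemma exists_Jacobson_ideal :
  exists J : right_ideal, forall x : R, x \in J <-> x \in Jacobson_radical R.
Proof.
have [||x a /asboolP xJ|J JP] :=
  @exists_right_ideal (fun x => x \in Jacobson_radical R).
- by apply/asboolP => m _; apply: right_ideal0.
- move=> x y /asboolP xJ /asboolP yJ; apply/asboolP => m maxm.
  by apply: right_idealD; [apply: xJ | apply: yJ].
- by apply/asboolP => m maxm; apply/right_idealM/xJ.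
by exists J.
Qed.

Lemma ideal_mul_eq0 (I J : {pred R}) :
  (forall x y, x \in I -> y \in J -> x * y = 0) -> ideal_mul I J =i pred1 0.
Proof.
move=> IJ0 x; rewrite [RHS]inE; apply/asboolP/eqP=> [[n [a [b [abIJ ->]]]]|->].
  by apply: big1 => i _; have [/IJ0 aI /aI] := abIJ i.
by exists 0, (fun=> 0), (fun=> 0); rewrite big_ord0; split=> [[]|].
Qed.

(** Whichever of the radical and the socle is contained in the other, its square lies in the product
    of the socle by the radical, which is zero. *)
Lemma Jacobson_or_socle_square_zero :
  (forall N : right_ideal, {subset N <= Soc (right_regular R)} \/
     {subset Soc (right_regular R) <= N}) ->
  ideal_mul (Jacobson_radical R) (Jacobson_radical R) =i pred1 0 \/
  ideal_mul (right_socle R) (right_socle R) =i pred1 0.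
Proof.
move=> comp; have [J JP] := exists_Jacobson_ideal.
have [JS|SJ] := comp J; [left|right]; apply: ideal_mul_eq0 => x y xI yI.
  by apply: socle_mul_Jacobson yI; apply/JS/JP.
by apply: socle_mul_Jacobson xI _; apply/JP/SJ.
Qed.

(** * Homogeneous semisimple rings as matrix rings *)

Definition sum_of_simples (n : nat) : Prop :=
  exists (S : 'I_n -> right_ideal) (y : 'I_n -> R),
    [/\ forall i, simple_submod (S i), forall i, y i \in S i
      & 1 = \sum_i y i].

(* A nontrivial relation among the summands would let one of them be absorbed
   by the others, giving a shorter decomposition of 1. *)
Lemma minimal_sum_independent n (S : 'I_n -> right_ideal) (y : 'I_n -> R) :
  (forall m, sum_of_simples m -> (n <= m)%N) ->
  (forall i, simple_submod (S i)) -> (forall i, y i \in S i) ->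
  1 = \sum_i y i ->
  forall z : 'I_n -> R, (forall i, z i \in S i) -> \sum_i z i = 0 ->
  forall i, z i = 0.
Proof.
case: n S y => [|n] S y nmin simpS yS y1 z zS zsum0 k; first by case: k.
apply: contrapT => /eqP zk0.
have /simple_right_idealP[_ /(_ (z k) (y k) (zS k) (yS k) zk0)[r yk]] := simpS k.
suff /nmin : sum_of_simples n by rewrite ltnn.
exists (fun i => S (lift k i)), (fun i => y (lift k i) + z (lift k i) * - r).
split=> // [i|]; first by apply: right_idealD => //; apply: right_idealM.
have : \sum_i (y i + z i * - r) = 1.
  by rewrite big_split /= -y1 -mulr_suml zsum0 mul0r addr0.
by rewrite (bigD1_ord k) //= mulrN -yk subrr add0r => ->.
Qed.

Lemma homogeneous_semisimple_matrix_ring :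
  homogeneous (right_regular R) -> semisimple (right_regular R) ->
  exists (D : unitRingType) (n : nat),
    [/\ division_ring D, (1 <= n)%N & ring_isomorphic R 'M[D]_n].
Proof.
move=> homR ssR.
have ex_sum : exists n, `[< sum_of_simples n >].
  have : (1 : R) \in right_socle R by rewrite /right_socle ssR.
  move=> /right_socleP[n [y [yS y1]]]; exists n; apply/asboolP.
  have /choice[S SP] i : exists S : right_ideal, simple_submod S /\ y i \in S.
    by have [S] := yS i; exists S.
  by exists S, y; split=> // i; case: (SP i).
(* The least number of summands will be the size of the matrices. *)
case: (ex_minnP ex_sum) => n /asboolP[S [y [simpS yS y1]]] nmin.
have indep := minimal_sum_independent (fun m ms => nmin m (asboolT ms)) simpS yS y1.
case: n S y simpS yS y1 indep {nmin} => [|n] S y simpS yS y1 indep.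
  by move/eqP: y1; rewrite big_ord0 oner_eq0.
(* Multiplying [1 = \sum_j y j] by [z] and comparing components in the independent [S j] shows that
   left multiplication by [y j] is the projection onto [S j]. *)
have yM i j (z : R) : z \in S i -> y j * z = z *+ (j == i).
  move=> zS; apply/subr0_eq.
  apply: (indep (fun j => y j * z - z *+ (j == i))) => [k|].
    apply: right_idealD; first exact: right_idealM.
    case: eqVneq => [->|_]; last by rewrite mulr0n oppr0 right_ideal0.
    by rewrite mulr1n -[z]mulr1 -mulrN right_idealM.
  rewrite sumrB -mulr_suml -y1 mul1r (bigD1 i) //= eqxx big1 ?addr0 ?subrr //.
  by move=> k /negPf->.
have yid i (z : R) : z \in S i -> y i * z = z by move/yM->; rewrite eqxx.
(* ab i = (phi_i y_0, phi_i^-1 y_i) for an isomorphism phi_i from S 0 to S i: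
   left multiplication by these elements is phi_i, resp. its inverse. *)
have ex_ab i : exists ab : R * R, [/\ ab.1 \in S i, ab.2 \in S ord0,
    ab.1 * ab.2 = y i, ab.2 * ab.1 = y ord0 & ab.2 * y i = ab.2].
  have [f [g fK gK]] := homR _ _ (simpS ord0) (simpS i).
  have f_inj := can_inj fK.
  have fM (u : submod (S ord0)) (r : R) :
      val (f ((r : R^c) *: u)) = (val (f u) : R) * r by rewrite linearZ.
  pose Y0 := Submod (yS ord0); pose Yi := Submod (yS i); pose u := g Yi.
  have fu : val (f u) = y i by rewrite gK.
  exists (val (f Y0), val u); split=> /=.
  - exact: valP.
  - exact: valP.
  - rewrite -fM -fu; congr (val (f _)); apply: val_inj.
    exact: yid (valP u).
  - have : f ((val (f Y0) : R^c) *: u) = f Y0.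
      by apply: val_inj; rewrite fM fu; apply/yid/valP.
    by move/f_inj/(congr1 val).
  - have : f ((y i : R^c) *: u) = f u by apply: val_inj; rewrite fM fu yid.
    by move/f_inj/(congr1 val).
have [ab abP] := choice ex_ab.
(* Left multiplication by [e i j] maps [S j] to [S i] through [S ord0]. *)
pose e i j := (ab i).1 * (ab j).2.
have ba j k : (ab j).2 * (ab k).1 = y ord0 *+ (j == k).
  have [a_k _ _ bak _] := abP k; have [_ _ _ _ <-] := abP j.
  (* With [y j] inserted between the factors, the product vanishes for [j != k] because [(ab k).1]
     lies in [S k]. *)
  rewrite -mulrA (yM k) //; case: eqVneq => [->|_]; last by rewrite mulr0.
  by rewrite !mulr1n.
have eM i j k l : e i j * e k l = e i l *+ (j == k).
  rewrite /e mulrA -[_ * _ * (ab k).1]mulrA ba mulrnAr mulrnAl -mulrA.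
  by have [_ bl _ _ _] := abP l; rewrite yid.
have e1 : \sum_i e i i = 1.
  by rewrite y1; apply: eq_bigr => i _; have [_ _ + _ _] := abP i.
have eS j : e ord0 j \in S ord0.
  by apply: right_idealM; have [] := abP ord0.
exists (centralizer (fun p => e p.1 p.2)), n.+1; split=> //.
  apply: (matrix_units_division eM e1 (o := ord0)) => x x0 ex.
  (* Both [x] and [e ord0 ord0] lie in the simple right ideal [S ord0], which the nonzero [x]
     generates. *)
  have /simple_right_idealP[_] := simpS ord0; apply=> //.
  by rewrite -ex right_idealM.
exact: matrix_units_isomorphism.
Qed.

End RightIdeals.

Theorem theorem2p22 (R : nzRingType) :
  (forall M : rmodType R,
     weakly_uniserial M -> Dedekind_finite (submod (Soc M)) ->
     (forall N : submodClosed M,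
        {subset N <= Soc M} \/ {subset Soc M <= N})
     /\ (Soc M =i pred1 0 \/ indecomposable M \/
         (homogeneous M /\ semisimple M)))
  /\
  (right_weakly_uniserial R ->
   Dedekind_finite (submod (Soc (right_regular R))) ->
     (ideal_mul (Jacobson_radical R) (Jacobson_radical R) =i pred1 0 \/
      ideal_mul (right_socle R) (right_socle R) =i pred1 0)
     /\ (Soc (right_regular R) =i pred1 0 \/
         indecomposable (right_regular R) \/
         exists (D : unitRingType) (n : nat),
           [/\ division_ring D, (1 <= n)%N & ring_isomorphic R 'M[D]_n])).
Proof.
split=> [M wuM Dfin|wuR Dfin].
  split; last exact: weakly_uniserial_soc_trichotomy.
  by move=> N; apply: weakly_uniserial_soc_comparable.
split.
  apply: Jacobson_or_socle_square_zero => N.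
  exact: weakly_uniserial_soc_comparable.
have [|[|[homR ssR]]] := weakly_uniserial_soc_trichotomy wuR Dfin; [by left| |].
  by right; left.
by right; right; apply: homogeneous_semisimple_matrix_ring.
Qed.
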